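(* For any tournament $T$ of order $n$, we have $\gamma_L(T)\leq\lceil n/2\rceil$ and the location number of $T$ is at most $\lfloor n/2\rfloor$.
   Context: A tournament has a unique arc between any pair of vertices. A set $S$ of vertices is locating if every vertex not in $S$ has a distinct set of in-neighbours in $S$; the location number is the minimum size of a locating set. A set is dominating if every vertex outside it has an in-neighbour in it, and locating-dominating if it is both locating and dominating; $\gamma_L(T)$ is the minimum size of a locating-dominating set. *)

(* Defs.v *)
From mathcomp Require Import all_boot.

Set Implicit Arguments.
Unset Strict Implicit.
Unset Printing Implicit Defensive.

(* A digraph on V is a relation [e : rel V], where [e x y] means that there is
   an arc from x to y. *)

Definition tournament (V : finType) (e : rel V) : Prop :=
  irreflexive e /\ forall x y : V, x != y -> e x y (+) e y x.

Section LocatingDominating.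

Variables (V : finType) (e : rel V).
Implicit Types (S : {set V}) (x y : V).

Definition in_nbrs x : {set V} := [set y | e y x].

Definition locating S : bool :=
  [forall x in ~: S, forall y in ~: S,
     (in_nbrs x :&: S == in_nbrs y :&: S) ==> (x == y)].

Definition dominating S : bool :=
  [forall x in ~: S, exists y in S, e y x].

Definition locating_dominating S : bool := locating S && dominating S.

(* The whole vertex set satisfies both predicates (see [locating_setT] and
   [locating_dominating_setT]), as required by the default value [setT] of
   [arg min]. *)
Definition location_number : nat :=
  #|[arg min_(S < [set: V] | locating S) #|S|]|.

Definition gammaL : nat :=
  #|[arg min_(S < [set: V] | locating_dominating S) #|S|]|.

Lemma locating_setT : locating [set: V].
Proof. by apply/forall_inP => x; rewrite !inE. Qed.

Lemma locating_dominating_setT : locating_dominating [set: V].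
Proof.
by rewrite /locating_dominating locating_setT; apply/forall_inP => x; rewrite !inE.
Qed.

End LocatingDominating.

(* Main.v *)
Require Import Defs.
From mathcomp Require Import all_boot.
From mathcomp Require Import zify.

Set Implicit Arguments.
Unset Strict Implicit.
Unset Printing Implicit Defensive.

(** Every vertex set A contains a set S of at most #|A|/2 vertices that separates
    A \ S, by induction on #|A|. Choose a nonempty S0 in A; it splits A \ S0
    into classes, and S is S0 together with separating sets of the classes. If
    at least #|S0| classes have odd size, the rounding pays for S0. When #|A|
    is even any single vertex will do as S0; when #|A| is odd, a vertex with
    odd in-degree in A. Otherwise A contains a cyclic triangle, and a parity
    check shows that some nonempty subset of its vertices has enough odd classes.

    For domination, add a source to the tournament: outside a separating set, an
    undominated vertex has the same code as the source. *)

(** * Sums and parities over classes *)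

Lemma big_bool3 (R : Type) (idx : R) (op : Monoid.com_law idx)
    (F : bool * bool * bool -> R) :
  \big[op/idx]_k F k =
    op (op (op (F (true, true, true)) (F (true, true, false)))
           (op (F (true, false, true)) (F (true, false, false))))
       (op (op (F (false, true, true)) (F (false, true, false)))
           (op (F (false, false, true)) (F (false, false, false)))).
Proof.
rewrite (eq_bigr (fun k => F (k.1, k.2))); last by case.
rewrite -(pair_bigA _ (fun p c => F (p, c))) /=.
rewrite (eq_bigr (fun p => op (F (p.1, p.2, true)) (F (p.1, p.2, false)))).
  by rewrite -(pair_bigA _ (fun a b => op (F (a, b, true)) (F (a, b, false))))
             !big_bool.
by case=> a b _; rewrite big_bool.
Qed.

Section Fibers.

Variables (V K : finType) (f : V -> K) (A : {set V}).

Lemma card_fibers : \sum_k #|[set v in A | f v == k]| = #|A|.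
Proof.
rewrite -sum1_card (partition_big f predT) //=; apply: eq_bigr => k _.
by rewrite -sum1_card; apply: eq_bigl => v; rewrite inE.
Qed.

Lemma odd_card_preim (p : pred K) :
  odd #|[set v in A | p (f v)]|
    = \big[addb/false]_k (p k && odd #|[set v in A | f v == k]|).
Proof.
have -> : #|[set v in A | p (f v)]| = \sum_k p k * #|[set v in A | f v == k]|.
  rewrite -sum1_card (partition_big f predT) //=; apply: eq_bigr => k _.
  rewrite -sum1_card big_distrr big_mkcond [RHS]big_mkcond.
  apply: eq_bigr => v _; rewrite !inE.
  by case: eqP => [->|_]; rewrite ?andbF // !andbT; case: (v \in A); case: (p k).
elim/big_rec2: _ => //= k b m _ <-.
by rewrite oddD oddM oddb.
Qed.

End Fibers.

Lemma card_bigcup_le (V K : finType) (g : K -> {set V}) :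
  #|\bigcup_k g k| <= \sum_k #|g k|.
Proof.
elim/big_rec2: _ => [|k m B _ le_Bm]; first by rewrite cards0.
by apply: leq_trans (leq_card_setU _ _) _; rewrite leq_add2l.
Qed.

Lemma card_setD1_pred (V : finType) (A : {set V}) x (P : pred V) : x \in A ->
  #|[set v in A | P v]| = P x + #|[set v in A :\ x | P v]|.
Proof.
move=> xA; rewrite (cardsD1 x) !inE xA; congr (_ + _); apply: eq_card => v.
by rewrite !inE andbA.
Qed.

(** A code lists the arcs from the three triangle vertices. Masking by [s] erases the bits of
    unselected vertices, so that one type of codes serves every subset of the triangle. *)
Definition mask (s k : bool * bool * bool) : bool * bool * bool :=
  (s.1.1 && k.1.1, s.1.2 && k.1.2, s.2 && k.2).

(* [n k] is the parity of the class with code [k] among the vertices outside the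
   triangle x -> y -> z -> x; the three extra terms account for the codes of x,
   y and z when they are not in the subset of {x, y, z} selected by [s]. *)
Lemma triangle_parity (n : bool * bool * bool -> bool) :
  exists2 s : bool * bool * bool, 0 < s.1.1 + s.1.2 + s.2 &
    s.1.1 + s.1.2 + s.2 <=
      \sum_k (((~~ s.1.1 && (mask s (false, false, true) == k))
             (+) (~~ s.1.2 && (mask s (true, false, false) == k)))
             (+) ((~~ s.2 && (mask s (false, true, false) == k))
             (+) \big[addb/false]_j ((mask s j == k) && n j))).
Proof.
pose good (s : bool * bool * bool) := (0 < s.1.1 + s.1.2 + s.2) && (s.1.1 + s.1.2 + s.2 <=
      \sum_k (((~~ s.1.1 && (mask s (false, false, true) == k))
             (+) (~~ s.1.2 && (mask s (true, false, false) == k)))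
             (+) ((~~ s.2 && (mask s (false, true, false) == k))
             (+) \big[addb/false]_j ((mask s j == k) && n j)))).
(* Only the eight parities [n k] matter, so computation settles the 256 cases by trying the seven
   nonempty subsets. *)
suff: has good [:: (true, false, false); (false, true, false); (false, false, true);
      (true, true, false); (true, false, true); (false, true, true); (true, true, true)].
  by case/hasP=> s _ /andP[]; exists s.
rewrite /good /= !big_bool3 /=.
case: (n (true, true, true)); case: (n (true, true, false));
   case: (n (true, false, true)); case: (n (true, false, false));
   case: (n (false, true, true)); case: (n (false, true, false));
   case: (n (false, false, true)); case: (n (false, false, false)); vm_compute; exact isT.
Qed.

(** * Separating sets of at most half the size *)

Section Separation.

Variables (V : finType) (e : rel V).
Implicit Types (A B S : {set V}) (x y z u v w : V).

Definition separating A S : Prop :=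
  forall u v, u \in A :\: S -> v \in A :\: S ->
    {in S, forall w, e w u = e w v} -> u = v.

Definition half_separable A : Prop :=
  exists S, [/\ S \subset A, #|S|.*2 <= #|A| & separating A S].

(** Each class needs at most half of its vertices, and an odd class saves one half by rounding;
    [#|S0|] such savings offset the excess of [S0] over half of its own size. As [f] depends only on
    the arcs from [S0], two vertices that the union fails to distinguish lie in one class, whose own
    set separates them. *)
Lemma half_separable_refine (K : finType) (f : V -> K) A S0 :
    (forall B, #|B| < #|A| -> half_separable B) ->
    S0 \subset A -> 0 < #|S0| ->
    (forall u v, {in S0, forall w, e w u = e w v} -> f u = f v) ->
    #|S0| <= \sum_k odd #|[set v in A :\: S0 | f v == k]| ->
  half_separable A.
Proof.
move=> IH sS0A S0_gt0 S0f.
have cardA : #|S0| + #|A :\: S0| = #|A| by rewrite -(cardsID S0 A) (setIidPr sS0A).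
have /fin_all_exists[g gP] : forall k, half_separable [set v in A :\: S0 | f v == k].
  move=> k; apply: IH; apply: (@leq_ltn_trans #|A :\: S0|); last by lia.
  by apply: subset_leq_card; apply/subsetP => v; rewrite inE => /andP[].
move=> odd_classes; exists (S0 :|: \bigcup_k g k); split.
- rewrite subUset sS0A; apply/bigcupsP => k _; have [sgC _ _] := gP k.
  by apply: subset_trans sgC _; apply/subsetP => v; rewrite !inE => /andP[/andP[]].
- have saved : \sum_k (#|g k|.*2 + odd #|[set v in A :\: S0 | f v == k]|)
               <= \sum_k #|[set v in A :\: S0 | f v == k]|.
    by apply: leq_sum => k _; have [_ le_gC _] := gP k; lia.
  have card_g : \sum_k #|g k|.*2 = (\sum_k #|g k|).*2.
    by rewrite -muln2 big_distrl /=; apply: eq_bigr => k _; rewrite muln2.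
  move: saved; rewrite big_split /= card_fibers card_g.
  have := (leq_card_setU S0 (\bigcup_k g k)).1; have := card_bigcup_le g.
  lia.
- move=> u v; rewrite !inE !negb_or => /andP[/andP[uS0 ug] uA] /andP[/andP[vS0 vg] vA].
  move=> eq_uv; have fuv : f u = f v.
    by apply: S0f => w wS0; apply: eq_uv; rewrite inE wS0.
  have [_ _ sep_g] := gP (f u).
  have notin_g t : t \notin \bigcup_k g k -> t \notin g (f u).
    by apply: contra => tg; apply/bigcupP; exists (f u).
  apply: sep_g.
  + by rewrite !inE uS0 uA eqxx notin_g.
  + by rewrite !inE vS0 vA fuv eqxx -fuv notin_g.
  by move=> w wg; apply: eq_uv; rewrite inE; apply/orP; right; apply/bigcupP; exists (f u).
Qed.

Hypothesis tourn_e : tournament e.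

Lemma tourn_irr x : e x x = false.
Proof. exact: (proj1 tourn_e). Qed.

Lemma tourn_arc x y : e x y -> (e y x = false) * (x != y).
Proof.
move=> exy; have ne_xy : x != y by apply: contraTneq exy => ->; rewrite tourn_irr.
by split=> //; have := (proj2 tourn_e) x y ne_xy; rewrite exy; case: (e y x).
Qed.

Lemma half_separable_triangle A x y z :
    (forall B, #|B| < #|A| -> half_separable B) ->
    x \in A -> y \in A -> z \in A -> e x y -> e y z -> e z x ->
  half_separable A.
Proof.
move=> IH xA yA zA exy eyz ezx.
have [eyx nxy] := tourn_arc exy; have [ezy nyz] := tourn_arc eyz.
have [exz nzx] := tourn_arc ezx.
pose code v := (e x v, e y v, e z v).
pose R := A :\ x :\ y :\ z.
have split3 (P : pred V) :
    #|[set v in A | P v]| = P x + (P y + (P z + #|[set v in R | P v]|)).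
  have yAx : y \in A :\ x by rewrite !inE yA eq_sym nxy.
  have zAxy : z \in A :\ x :\ y by rewrite !inE zA nzx eq_sym nyz.
  by rewrite (card_setD1_pred P xA) (card_setD1_pred P yAx) (card_setD1_pred P zAxy).
(* The parities for full codes outside the triangle determine those for masked codes, by
   [odd_card_preim]. *)
have [s s_gt0 s_odd] := triangle_parity (fun k => odd #|[set v in R | code v == k]|).
pose S0 := [set v | [|| s.1.1 && (v == x), s.1.2 && (v == y) | s.2 && (v == z)]].
have sS0A : S0 \subset A.
  by apply/subsetP => v; rewrite inE => /or3P[] /andP[_ /eqP->].
have RS0 v : v \in R -> v \notin S0.
  by rewrite !inE => /and4P[/negPf-> /negPf-> /negPf-> _]; rewrite !andbF.
have xS0 : (x \in S0) = s.1.1.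
  by rewrite inE eqxx (negPf nxy) eq_sym (negPf nzx) !andbF andbT !orbF.
have yS0 : (y \in S0) = s.1.2.
  by rewrite inE eqxx eq_sym (negPf nxy) (negPf nyz) !andbF andbT orbF.
have zS0 : (z \in S0) = s.2.
  by rewrite inE eqxx (negPf nzx) eq_sym (negPf nyz) !andbF andbT.
have cardS0 : #|S0| = s.1.1 + s.1.2 + s.2.
  have -> : S0 = [set v in A | v \in S0].
    apply/setP => v; rewrite [RHS]in_set andb_idl //; exact: (subsetP sS0A).
  rewrite split3 xS0 yS0 zS0.
  have -> : [set v in R | v \in S0] = set0.
    by apply/setP => v; rewrite [LHS]in_set in_set0; apply/andP => -[/RS0/negP].
  by rewrite cards0 addn0 addnA.
apply: (half_separable_refine (f := mask s \o code) IH sS0A); first by rewrite cardS0.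
- move=> u v eq_uv; rewrite /mask /=.
  by congr (_, _, _); apply: andb_id2l => bit; apply: eq_uv; rewrite inE bit eqxx ?orbT.
rewrite cardS0; apply: leq_trans s_odd _; apply: leq_sum => k _.
have -> : [set v in A :\: S0 | (mask s \o code) v == k]
          = [set v in A | (v \notin S0) && (mask s (code v) == k)].
  by apply/setP => v; rewrite !in_set /= -andbA andbCA.
rewrite split3 !oddD !oddb xS0 yS0 zS0.
have -> : [set v in R | (v \notin S0) && (mask s (code v) == k)]
          = [set v in R | mask s (code v) == k].
  by apply/setP => v; rewrite [LHS]in_set [RHS]in_set; apply: andb_id2l => /RS0->.
rewrite (odd_card_preim code R (fun j => mask s j == k)).
by rewrite /code !tourn_irr exy eyz ezx eyx ezy exz !addbA.
Qed.

Lemma half_separable_all A : half_separable A.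
Proof.
have [m] := ubnP #|A|; elim: m A => // m IHm A; rewrite ltnS => leAm.
have IH B : #|B| < #|A| -> half_separable B by move=> ltBA; apply: IHm; lia.
have [A_le1|A_gt1] := leqP #|A| 1.
  exists set0; rewrite cards0 sub0set; split=> // u v.
  by rewrite setD0 => uA vA _; apply: (card_le1_eqP A_le1).
pose indeg x := #|[set v in A | e v x]|.
have [/existsP[x /andP[xA odd_x]]|noodd] :=
    boolP [exists x in A, ~~ odd #|A| || odd (indeg x)].
  (* One odd class is needed. If [#|A|] is even, the two classes have an odd total; otherwise the
     class of in-neighbours of [x] is odd by choice of [x]. *)
  apply: (half_separable_refine (f := e x) IH (S0 := [set x])).
  - by rewrite sub1set.
  - by rewrite cards1.
  - by move=> u v; apply; rewrite inE.
  pose C b := #|[set v in A :\ x | e x v == b]|.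
  have cardC : C true + C false = #|A :\ x| by rewrite -(card_fibers (e x)) big_bool.
  have cardA : #|A| = (#|A :\ x|).+1 by rewrite (cardsD1 x) xA.
  have indegE : indeg x = C false.
    apply: eq_card => v; rewrite !inE.
    case: (eqVneq v x) => [->|/(proj2 tourn_e)]; first by rewrite tourn_irr andbF.
    by case: (v \in A); case: (e x v); case: (e v x).
  rewrite cards1 big_bool; change (0 < odd (C true) + odd (C false)).
  by move: odd_x; rewrite indegE; lia.
(* From here on, [#|A|] is odd and all in-degrees within [A] are even. *)
have even_deg x : x \in A -> ~~ odd (indeg x).
  by move=> xA; move/existsPn/(_ x): noodd; rewrite xA negb_or => /andP[].
have pos_deg u v : u \in A -> e u v -> 0 < indeg v.
  by move=> uA euv; apply/card_gt0P; exists u; rewrite inE uA.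
have [x0 /andP[x0A x0_gt0]] : exists x, (x \in A) && (0 < indeg x).
  have /card_gt1P[u [v [uA vA /(proj2 tourn_e)]]] := A_gt1.
  case euv: (e u v) => evu; first by exists v; rewrite vA (pos_deg u).
  by exists u; rewrite uA (pos_deg v).
have [] := @arg_minnP _ x0 (fun x => (x \in A) && (0 < indeg x)) indeg.
  by rewrite x0A.
move=> x /andP[xA x_gt0] min_x.
(* The least positive in-degree is even, so there is an arc y -> z inside the
   in-neighbourhood of x; by minimality z has an in-neighbour w outside it, and
   x -> w -> z -> x is a cyclic triangle. *)
have [z [y]] : exists z y, [/\ y \in A, z \in A, e y z & e z x].
  have /card_gt1P[u [v []]] : 1 < indeg x by have := even_deg x xA; lia.
  rewrite !inE => /andP[uA eux] /andP[vA evx] /(proj2 tourn_e).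
  by case euv: (e u v) => evu; [exists v, u | exists u, v].
move=> [yA zA eyz ezx].
have /subsetPn[w] : ~~ ([set v in A | e v z] \subset [set v in A | e v x]).
  (* An inclusion would be proper, since [z] is an in-neighbour of [x] but not of itself; yet [y]
     makes the in-degree of [z] positive. *)
  apply/negP => sub_zx; have := min_x z; rewrite zA (pos_deg y) // => /(_ isT).
  rewrite leqNgt => /negP; apply; apply/proper_card/properP; split=> //.
  by exists z; rewrite !inE zA ?tourn_irr.
rewrite !inE => /andP[wA ewz]; rewrite wA /= => nwx.
apply: (half_separable_triangle IH xA wA zA _ ewz ezx).
have : w != x by apply: contraTneq ewz => ->; rewrite (tourn_arc ezx).1.
by move/(proj2 tourn_e); rewrite (negPf nwx).
Qed.

End Separation.

(** * Locating and locating-dominating sets *)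

Definition add_source (V : finType) (e : rel V) : rel (option V) :=
  fun u v => match u, v with
  | Some x, Some y => e x y
  | None, Some _ => true
  | _, None => false
  end.

Lemma tournament_add_source (V : finType) (e : rel V) :
  tournament e -> tournament (add_source e).
Proof.
case=> irr_e arc_e; split=> [[x|]|[x|] [y|]] //=.
by move=> ne_xy; apply: arc_e; apply: contraNneq ne_xy => ->.
Qed.

Lemma location_number_le (V : finType) (e : rel V) S :
  locating e S -> location_number e <= #|S|.
Proof.
rewrite /location_number; case: arg_minnP => [|T _ min_T /min_T //].
exact: locating_setT.
Qed.

Lemma gammaL_le (V : finType) (e : rel V) S :
  locating_dominating e S -> gammaL e <= #|S|.
Proof.
rewrite /gammaL; case: arg_minnP => [|T _ min_T /min_T //].
exact: locating_dominating_setT.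
Qed.

Lemma locatingP (V : finType) (e : rel V) (S : {set V}) :
  reflect (forall u v, u \notin S -> v \notin S ->
             {in S, forall w, e w u = e w v} -> u = v)
          (locating e S).
Proof.
apply: (iffP forall_inP) => [loc u v uS vS eq_uv | sep u].
  have uS' : u \in ~: S by rewrite inE.
  move/forall_inP/(_ v): (loc u uS'); rewrite inE => /(_ vS) /implyP eq_impl.
  apply/eqP/eq_impl/eqP/setP => w; rewrite !inE.
  by case wS: (w \in S); rewrite ?andbF // !andbT eq_uv.
rewrite inE => uS; apply/forall_inP => v; rewrite inE => vS; apply/implyP => /eqP/setP eq_uv.
by apply/eqP/sep => // w wS; have := eq_uv w; rewrite !inE wS !andbT.
Qed.

Lemma locating_sub (V : finType) (e : rel V) (S T : {set V}) :
  S \subset T -> locating e S -> locating e T.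
Proof.
move=> /subsetP sST /locatingP loc; apply/locatingP => u v uT vT eq_uv.
apply: loc => [||w /sST/eq_uv //]; [exact: contra (sST u) uT | exact: contra (sST v) vT].
Qed.

(** An undominated vertex has no in-neighbour in [S], so a locating [S] leaves at most one, and
    adding it to [S] suffices. *)
Lemma locating_dominating_extend (V : finType) (e : rel V) (S : {set V}) :
  locating e S -> exists2 T, locating_dominating e T & #|T| <= #|S|.+1.
Proof.
move=> locS; have [domS|/forall_inPn[u uS undom]] := boolP (dominating e S).
  by exists S; rewrite // /locating_dominating locS.
rewrite inE in uS; exists (u |: S); last by rewrite cardsU1 uS.
rewrite /locating_dominating (locating_sub (subsetUr _ _) locS) /=.
apply/forall_inP => v; rewrite !inE negb_or => /andP[ne_vu vS].
apply: contraTT ne_vu => undom_v; rewrite negbK; apply/eqP.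
move/locatingP: locS => sepS; apply: sepS => // w wS; transitivity false.
  apply: contraNF undom_v => ewv; apply/existsP; exists w.
  by rewrite !inE wS orbT.
apply/esym; apply: contraNF undom => ewu; apply/existsP; exists w; exact/andP.
Qed.

Theorem theorem13 (V : finType) (e : rel V) (n : nat)
    (tourn_e : tournament e) (order_V : #|V| = n) :
  gammaL e <= uphalf n /\ location_number e <= n./2.
Proof.
split.
  have [S [_ leS sepS]] := half_separable_all (tournament_add_source tourn_e) setT.
  have sep_out u v : u \notin S -> v \notin S ->
      {in S, forall w, add_source e w u = add_source e w v} -> u = v.
    by move=> uS vS; apply: sepS; rewrite !inE ?uS ?vS.
  (* The source raises the order to [n.+1], whose half rounded down is [uphalf n]. *)
  rewrite cardsT card_option order_V in leS.
  pose T : {set V} := [set x | Some x \in S].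
  have SomeI : injective (@Some V) by move=> ? ? [].
  have cardS : #|S| = (None \in S) + #|T|.
    rewrite (cardsD1 None); congr (_ + _).
    rewrite -(card_imset (mem T) SomeI); apply: eq_card => -[x|].
      by rewrite mem_imset ?inE.
    by rewrite !inE /=; apply/esym/imsetP => -[].
  (* The source has arcs to all of [V], so it never distinguishes two vertices of [V]. *)
  have locT : locating e T.
    apply/locatingP => u v; rewrite !inE => uS vS eq_uv.
    apply/SomeI/sep_out => // -[w|] //= wS.
    by apply: eq_uv; rewrite inE.
  (* If the source is in [S], dropping it leaves room for one more vertex; if not, separation from
     the source forces domination. *)
  case: (boolP (None \in S)) cardS => noneS cardS.
    have [T' /gammaL_le leT' leTT'] := locating_dominating_extend locT.
    by lia.
  suff /gammaL_le : locating_dominating e T by lia.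
  rewrite /locating_dominating locT; apply/forall_inP => v; rewrite 2!in_set => vS.
  apply: contraT => /exists_inPn undom.
  have // : None = Some v.
  apply: sep_out => // -[w|] wS /=; last by rewrite wS in noneS.
  by apply/esym/negbTE/undom; rewrite inE.
have [S [_ leS sepS]] := half_separable_all tourn_e setT.
rewrite cardsT order_V in leS.
suff /location_number_le : locating e S by lia.
by apply/locatingP => u v uS vS; apply: sepS; rewrite !inE ?uS ?vS.
Qed.
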